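(* If $n\ge m\ge 1$, then $$\mathrm{mob}(K_n\,\square\, K_m)=\begin{cases} n, & m\in\{1,2\},\\ n+m-3, & m\ge 3.\end{cases}$$
   Context: $\square$ denotes the Cartesian product: vertex set $V(G)\times V(H)$, $(g,h)\sim(g',h')$ iff ($gg'\in E(G)$, $h=h'$) or ($g=g'$, $hh'\in E(H)$). A set $S\subseteq V(G)$ is a general position set if no three vertices of $S$ lie on a common shortest path. Robots are placed one per vertex of a general position set $S$; a move $u\to v$ along an edge $uv$ with $u\in S$ is legal if $v\notin S$ and $(S\setminus\{u\})\cup\{v\}$ is a general position set. $S$ is a mobile general position set if some sequence of legal moves starting from $S$ visits every vertex at least once; $\mathrm{mob}(G)$ is the maximum size of a mobile general position set. *)

(* Defs.v *)
From mathcomp Require Import all_boot.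
From mathcomp Require Import boolp.

Set Implicit Arguments.
Unset Strict Implicit.
Unset Printing Implicit Defensive.

(* A finite simple graph is a symmetric irreflexive [e : rel T], [T : finType]. *)

Definition complete_graph (n : nat) : rel 'I_n := fun i j => i != j.

Definition cart_prod (T U : finType) (e : rel T) (f : rel U) : rel (T * U) :=
  fun x y => (e x.1 y.1 && (x.2 == y.2)) || ((x.1 == y.1) && f x.2 y.2).

Lemma complete_graph_sym n : symmetric (@complete_graph n).
Proof. by move=> i j; rewrite /complete_graph eq_sym. Qed.

Lemma complete_graph_irr n : irreflexive (@complete_graph n).
Proof. by move=> i; rewrite /complete_graph eqxx. Qed.

Lemma cart_prod_sym (T U : finType) (e : rel T) (f : rel U) :
  symmetric e -> symmetric f -> symmetric (cart_prod e f).
Proof.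
by move=> es fs x y; rewrite /cart_prod es fs (eq_sym x.1) (eq_sym x.2).
Qed.

Lemma cart_prod_irr (T U : finType) (e : rel T) (f : rel U) :
  irreflexive e -> irreflexive f -> irreflexive (cart_prod e f).
Proof. by move=> ei fi x; rewrite /cart_prod ei fi andbF. Qed.

Section MobileGeneralPosition.
Variables (T : finType) (e : rel T).
Implicit Types (S : {set T}) (x u v w : T) (p q : seq T).

(* The vertices of the path are those of [x :: p]; its length is [size p]. *)
Definition shortest_path x p : Prop :=
  path e x p /\
  forall q, path e x q -> last x q = last x p -> size p <= size q.

Definition general_position S : Prop :=
  forall u v w, u \in S -> v \in S -> w \in S ->
    u != v -> u != w -> v != w ->
    ~ exists x p, shortest_path x p /\ {subset [:: u; v; w] <= x :: p}.

Definition legal_move S S' : Prop :=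
  exists u v, [/\ u \in S, e u v, v \notin S,
    S' = v |: (S :\ u) & general_position S'].

(* [C 0, ..., C k] are the successive sets of occupied vertices; the vertices
   of [S = C 0] count as visited. *)
Definition mobile S : Prop :=
  general_position S /\
  exists (k : nat) (C : nat -> {set T}),
    [/\ C 0 = S,
        forall i, i < k -> legal_move (C i) (C i.+1)
      & forall x, exists2 i, i <= k & x \in C i].

Definition mob : nat := \max_(S : {set T} | `[< mobile S >]) #|S|.

End MobileGeneralPosition.

(* Main.v *)
Require Import Defs.
From mathcomp Require Import all_boot.
From mathcomp Require Import boolp zify.

Set Implicit Arguments.
Unset Strict Implicit.
Unset Printing Implicit Defensive.

(** Two vertices of the rook's graph [K_n □ K_m] are at distance at most 2, so a
    set is in general position iff it contains no "corner" [(a,b), (a,d), (c,d)]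
    with [a != c] and [b != d].  Hence each of its points is alone in its row or
    alone in its column.  Counting the two kinds of points separately gives at
    most [n + m - 2] points if both kinds occur (at most [max n m] otherwise),
    and for [3 <= m <= n] equality forces a cross without its centre.  From such
    a cross no move is legal, so its centre is never visited.

    Conversely, legal moves are reversible, so a set is mobile as soon as every
    vertex is occupied in some configuration reachable from it.  For [m = 2] the
    robots of one copy of [K_n] change copy one after another.  For [m >= 3],
    start from a cross without its centre [(0,0)] and without one further point;
    the centre becomes accessible after the points of the arm [{0} x K_m] have
    been moved one by one, all but the last one, to [{1} x K_m]. *)

(** * Reversible moves and mobility by reachability *)

Section Reversibility.
Variables (T : finType) (e : rel T).
Hypothesis e_sym : symmetric e.

(** [legal_move] constrains only its target; requiring general position of the source as well makes
    the relation symmetric. *)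
Definition legal_step : rel {set T} :=
  fun S S' => `[< general_position e S /\ legal_move e S S' >].

Lemma legal_step_sym : symmetric legal_step.
Proof.
suff imp S S' : legal_step S S' -> legal_step S' S.
  by move=> S S'; apply/idP/idP; apply: imp.
move=> /asboolP [gS [u [v [uS euv vS -> gS']]]]; apply/asboolP; split=> //.
have uv : u != v by apply: contraNneq vS => <-.
exists v, u; split=> //.
- by rewrite !inE eqxx.
- by rewrite e_sym.
- by rewrite !inE eqxx (negPf uv).
apply/setP=> x; rewrite !inE.
case: (eqVneq x u) => [->|_] //=; case: (eqVneq x v) => [->|_] //=.
exact: negPf vS.
Qed.

(** The tour is built vertex by vertex: by symmetry the robots can return from the current
    configuration to [S], and from there go on to one that occupies the next vertex. *)
Lemma mobile_connect S : general_position e S ->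
  (forall x, exists2 S', connect legal_step S S' & x \in S') -> mobile e S.
Proof.
move=> gS cov; split=> //.
have [p pP pcov] : exists2 p, path legal_step S p &
    forall x, x \in enum T -> exists2 S', S' \in S :: p & x \in S'.
  elim: (enum T) => [|x xs [p pP IH]]; first by exists [::].
  have [S' cS' xS'] := cov x.
  have : connect legal_step (last S p) S'.
    apply: connect_trans cS'; rewrite (sym_connect_sym legal_step_sym).
    by apply/connectP; exists p.
  move=> /connectP [q qP qE]; exists (p ++ q); first by rewrite cat_path pP.
  move=> y; rewrite inE => /predU1P [->|yxs].
    by exists S' => //; rewrite qE -last_cat mem_last.
  have [S'' S''p yS''] := IH y yxs; exists S'' => //.
  by rewrite -cat_cons mem_cat S''p.
exists (size p), (nth S (S :: p)); split=> // [i ltip|x].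
  by have /asboolP [] := pathP S pP i ltip.
have [S' /(nthP S) [i ltip <-] xS'] := pcov x (mem_enum _ x).
by exists i.
Qed.

End Reversibility.

(** * General position in the rook's graph *)

Section RookGraph.
Variables n m : nat.
Notation V := ('I_n * 'I_m)%type.
Notation rook := (cart_prod (@complete_graph n) (@complete_graph m)).
Implicit Types (S : {set V}) (x y : V).

Lemma rook_sym : symmetric rook.
Proof. exact: cart_prod_sym (@complete_graph_sym n) (@complete_graph_sym m). Qed.

Definition corner_free S := forall a b c d,
  (a, b) \in S -> (a, d) \in S -> (c, d) \in S -> a = c \/ b = d.

Lemma general_position_corner_free S : general_position rook S -> corner_free S.
Proof.
move=> gS a b c d ab ad cd.
have [->|nac] := eqVneq a c; first by left.
have [->|nbd] := eqVneq b d; first by right.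
case: (gS _ _ _ ab ad cd); rewrite ?xpair_eqE ?eqxx ?(negPf nac) ?(negPf nbd) //.
(* The corner is itself a geodesic: its ends differ in both coordinates, so no path of length 0 or 1
   joins them. *)
exists (a, b), [:: (a, d); (c, d)]; split=> //; split=> [|[|y [|z q]]] //=.
- by rewrite /cart_prod /complete_graph /= !eqxx nac nbd !orbT.
- by move=> _ [/eqP]; rewrite (negPf nac).
- move=> /[swap] ->; rewrite /cart_prod /complete_graph /= (negPf nac) (negPf nbd).
  by rewrite andbF.
Qed.

Lemma rook_shortest_path_size x p : shortest_path rook x p ->
  size p <= (x.1 != (last x p).1) + (x.2 != (last x p).2).
Proof.
move=> [_ minp]; move: minp; case: x (last x p) => a b [c d] /=.
have [->|nac] := eqVneq a c; have [->|nbd] := eqVneq b d => minp.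
- exact: (minp [::]).
- by apply: (minp [:: (c, d)]); rewrite //= /cart_prod /complete_graph /= nbd eqxx orbT.
- by apply: (minp [:: (c, d)]); rewrite //= /cart_prod /complete_graph /= nac eqxx.
- apply: (minp [:: (a, d); (c, d)]) => //=.
  by rewrite /cart_prod /complete_graph /= nac nbd !eqxx orbT.
Qed.

Lemma corner_free_general_position S : corner_free S -> general_position rook S.
Proof.
move=> cS u v w uS vS wS uv uw vw [x [p [sp sub]]].
have uvw : uniq [:: u; v; w] by rewrite /= !inE negb_or uv uw vw.
have lep := rook_shortest_path_size sp.
have := uniq_leq_size uvw sub; case: sp => pP _; move: pP lep sub.
case: p => [|y [|z [|t p]]] //=; last first.
  by move=> _; do 2!case: (_ != _).
move=> /andP [xy /andP [yz _]] lep sub _.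
(* A geodesic has at most three vertices, so it consists of exactly [u], [v], [w] in some order and
   lies inside [S]. *)
have [_ eqi] := uniq_min_size uvw sub isT.
have inS t : t \in [:: x; y; z] -> t \in S.
  by rewrite -eqi !inE => /or3P [] /eqP ->.
have [xS yS zS] : [/\ x \in S, y \in S & z \in S].
  by split; apply: inS; rewrite !inE eqxx ?orbT.
move: x y z xy yz lep xS yS zS {sub eqi inS} => [a b] [c d] [e f] /=.
rewrite /cart_prod /complete_graph /=.
have [_|nae] := eqVneq a e; first by case: (b == f).
have [_|nbf] := eqVneq b f; first by [].
(* The ends differ in both coordinates, so the two edges have different directions and the middle
   vertex is the bend of a corner. *)
move=> /orP [/andP [ac /eqP bd]|/andP [/eqP ac bd]].
- subst d; rewrite (negPf nbf) andbF /= => /andP [/eqP ce _] _ xS yS zS.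
  subst e; case: (cS _ _ _ _ zS yS xS) => [/eqP|/eqP].
  + by rewrite eq_sym (negPf ac).
  + by rewrite eq_sym (negPf nbf).
- subst c; rewrite (negPf nae) /= orbF => /eqP df _ xS yS zS.
  subst f; case: (cS _ _ _ _ xS yS zS) => /eqP; [by rewrite (negPf nae)|].
  by rewrite (negPf bd).
Qed.

(** * Counting points alone in their column or in their row *)

Definition alone_in_col S := [set x in S | [forall y in S, (y.2 == x.2) ==> (y == x)]].

Lemma alone_in_col_inj S : {in alone_in_col S &, injective snd}.
Proof.
move=> x y; rewrite !inE => /andP [xS _] /andP [_ /forall_inP /(_ x xS)].
by move=> /implyP h /eqP /h /eqP.
Qed.

Lemma not_alone_in_col S x : x \in S :\: alone_in_col S ->
  exists i, [/\ i != x.1, (i, x.2) \in S & x \in S].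
Proof.
case: x => k l; rewrite !inE => /andP [nal xS]; move: nal; rewrite xS /=.
move=> /forall_inPn [[i j] yS]; rewrite negb_imply /= => /andP [/eqP jl].
by subst j; rewrite xpair_eqE eqxx andbT => nik; exists i.
Qed.

(** A second point in the row of [x], together with a second point in its column, would form a
    corner bent at [x]. *)
Lemma alone_in_row S x y : corner_free S ->
  x \in S :\: alone_in_col S -> y \in S -> y.1 = x.1 -> y = x.
Proof.
move=> cS /not_alone_in_col [i []]; case: x y => [a b] [c d] /= nia iS xS yS ca.
subst c; case: (cS _ _ _ _ yS xS iS) => [/eqP|-> //].
by rewrite eq_sym (negPf nia).
Qed.

Definition single_cols S : {set 'I_m} := snd @: alone_in_col S.
Definition single_rows S : {set 'I_n} := fst @: (S :\: alone_in_col S).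

(** The column projection is injective on the points alone in their column, and the row projection
    on all the others. *)
Lemma corner_free_card_parts S : corner_free S ->
  #|S| = #|single_cols S| + #|single_rows S|.
Proof.
move=> cS; rewrite (card_in_imset (@alone_in_col_inj S)) card_in_imset.
  rewrite -(cardsID (alone_in_col S) S) (setIidPr _) //.
  by apply/subsetP=> x; rewrite inE => /andP [].
move=> x y xB yB xy; apply: (alone_in_row cS yB) => //.
by move: xB; rewrite inE => /andP [].
Qed.

Lemma alone_in_col_snd S x : x \in S :\: alone_in_col S ->
  x.2 \notin single_cols S.
Proof.
move=> xB; apply/imsetP=> -[y]; have [i [nix iS xS]] := not_alone_in_col xB.
rewrite inE => /andP [_ /forall_inP al] xy.
have := al _ iS; rewrite /= xy eqxx /= => /eqP iy.
have := al _ xS; rewrite /= xy eqxx /= => /eqP x_y.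
by move: nix; rewrite x_y -iy eqxx.
Qed.

Lemma alone_in_row_fst S x : corner_free S -> x \in alone_in_col S ->
  x.1 \notin single_rows S.
Proof.
move=> cS xA; apply/imsetP=> -[y yB xy].
have xS : x \in S by move: xA; rewrite inE => /andP [].
by move: (yB); rewrite -(alone_in_row cS yB xS xy) inE xA.
Qed.

Lemma card_set_ord (k : nat) (D : {set 'I_k}) : #|D| <= k.
Proof. by rewrite (leq_trans (max_card _)) ?card_ord. Qed.

Lemma card_notin (k : nat) (D : {set 'I_k}) i : i \notin D -> #|D| <= k.-1.
Proof.
move=> iD; have <- : #|[set~ i]| = k.-1 by rewrite cardsC1 card_ord.
apply: subset_leq_card.
by apply/subsetP=> l lD; rewrite !inE; apply: contraNneq iD => <-.
Qed.

Lemma notin_card_pred (k : nat) (D : {set 'I_k}) i j :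
  #|D| = k.-1 -> i \notin D -> (j \in D) = (j != i).
Proof.
move=> Dk iD; suff -> : D = [set~ i] by rewrite !inE.
apply/eqP; rewrite eqEcard cardsC1 card_ord Dk leqnn andbT.
by apply/subsetP=> l lD; rewrite !inE; apply: contraNneq iD => <-.
Qed.

Lemma corner_free_card S : corner_free S -> #|S| <= maxn (maxn n m) (n + m - 2).
Proof.
move=> cS; rewrite (corner_free_card_parts cS).
have leC := card_set_ord (single_cols S); have leR := card_set_ord (single_rows S).
have [A0|[x xA]] := set_0Vmem (alone_in_col S).
  have : #|single_cols S| = 0 by rewrite /single_cols A0 imset0 cards0.
  lia.
have [B0|[y yB]] := set_0Vmem (S :\: alone_in_col S).
  have : #|single_rows S| = 0 by rewrite /single_rows B0 imset0 cards0.
  lia.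
(* When both kinds of points occur, the row of [x] and the column of [y] go uncounted, which saves
   one on each side. *)
have := card_notin (alone_in_row_fst cS xA); have := card_notin (alone_in_col_snd yB).
by have := ltn_ord x.1; have := ltn_ord x.2; lia.
Qed.

(** * Corner-free sets of maximum size *)

Definition cross (r : 'I_n) (c : 'I_m) : {set V} :=
  [set x | (x.1 == r) (+) (x.2 == c)].

Lemma corner_free_extremal S : 2 < n -> 2 < m -> corner_free S ->
  #|S| = n + m - 2 -> exists r c, S = cross r c.
Proof.
move=> n3 m3 cS; have := corner_free_card_parts cS.
have leC := card_set_ord (single_cols S); have leR := card_set_ord (single_rows S).
have [A0|[x xA]] := set_0Vmem (alone_in_col S).
  have : #|single_cols S| = 0 by rewrite /single_cols A0 imset0 cards0.
  lia.
have [B0|[y yB]] := set_0Vmem (S :\: alone_in_col S).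
  have : #|single_rows S| = 0 by rewrite /single_rows B0 imset0 cards0.
  lia.
have xR := alone_in_row_fst cS xA; have yC := alone_in_col_snd yB.
move: leC leR (card_notin xR) (card_notin yC) => _ _ ltR ltC eS nS.
have eC : #|single_cols S| = m.-1 by lia.
have eR : #|single_rows S| = n.-1 by lia.
(* By equality, [x.1] is the only row missing from [single_rows] and [y.2] the only column missing
   from [single_cols]; they meet at the centre of the cross. *)
have inA z : z \in alone_in_col S -> z.1 = x.1 /\ z.2 != y.2.
  move=> zA; split; last first.
    by rewrite -(notin_card_pred _ eC yC); apply: imset_f.
  have := alone_in_row_fst cS zA; rewrite (notin_card_pred _ eR xR) negbK.
  by move/eqP.
have inB z : z \in S :\: alone_in_col S -> z.1 != x.1 /\ z.2 = y.2.
  move=> zB; split.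
    by rewrite -(notin_card_pred _ eR xR); apply: imset_f.
  have := alone_in_col_snd zB; rewrite (notin_card_pred _ eC yC) negbK.
  by move/eqP.
exists x.1, y.2; apply/setP=> -[i j]; rewrite [RHS]inE /=; apply/idP/idP.
- move=> zS; have [zA|zA] := boolP ((i, j) \in alone_in_col S).
    by have [/= -> /negPf ->] := inA _ zA; rewrite eqxx.
  have zB : (i, j) \in S :\: alone_in_col S by rewrite in_setD zA.
  by have [/= /negPf -> ->] := inB _ zB; rewrite eqxx.
- have [->|ni] /= := eqVneq i x.1.
    rewrite -(notin_card_pred _ eC yC) => /imsetP [z zA ->].
    have [<- _] := inA z zA; rewrite -surjective_pairing.
    by move: zA; rewrite inE => /andP [].
  move=> /eqP ->; move: ni; rewrite -(notin_card_pred _ eR xR).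
  move=> /imsetP [z zB ->]; have [_ <-] := inB z zB.
  by rewrite -surjective_pairing; move: zB; rewrite inE => /andP [].
Qed.

(** * Immobility of the cross and the upper bound for [m >= 3] *)

Lemma exists_third k (i j : 'I_k) : 2 < k -> exists l, l != i /\ l != j.
Proof.
move=> k3; have : [set i; j] != setT.
  by apply: contraTneq k3 => ijT; rewrite -[k]card_ord -cardsT -ijT cards2 -leqNgt;
    case: (_ != _).
rewrite -properT properE => /andP [_ /subsetPn [l _]].
by rewrite !inE negb_or => /andP []; exists l.
Qed.

Lemma cross_stuck r c S : 2 < n -> 2 < m -> ~ legal_move rook (cross r c) S.
Proof.
move=> n3 m3 [[p q] [[a b] [_ _ vS -> /general_position_corner_free cS]]].
set S' := _ |: _ in cS.
have cS' i j k l : i != k -> j != l ->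
    (i, j) \in S' -> (i, l) \in S' -> (k, l) \in S' -> False.
  by move=> nik njl ij il kl; case: (cS _ _ _ _ ij il kl) => /eqP; apply/negP.
have in_cross i j : (i, j) != (p, q) -> (i == r) (+) (j == c) -> (i, j) \in S'.
  by move=> ne xij; rewrite !inE ne xij orbT.
have vS' : (a, b) \in S' by rewrite !inE eqxx.
move: vS; rewrite inE /=.
have [ar|nar] := eqVneq a r; have [bc|nbc] := eqVneq b c => //= _.
(* The target is the centre: a corner bent there uses one robot of each arm, both chosen away from
   the vacated cell. *)
- subst a b; have [i [nir nip]] := exists_third r p n3.
  have [j [njc njq]] := exists_third c q m3.
  apply: (cS' r j i c) => //; first by rewrite eq_sym.
  + by apply: in_cross; rewrite ?xpair_eqE ?(negPf njq) ?andbF // eqxx (negPf njc).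
  + by apply: in_cross; rewrite ?xpair_eqE ?(negPf nip) // eqxx (negPf nir).
(* The target is off both arms. It forms a corner with its projections [(a, c)] and [(r, b)]; if one
   of them was vacated, the other one and a further robot of its arm replace it. *)
- have arm_c i : i != r -> (i, c) != (p, q) -> (i, c) \in S'.
    by move=> /negPf nir ne; apply: in_cross; rewrite // nir eqxx.
  have arm_r j : j != c -> (r, j) != (p, q) -> (r, j) \in S'.
    by move=> /negPf njc ne; apply: in_cross; rewrite // njc eqxx.
  have [[rp bq]|urb] := eqVneq (r, b) (p, q).
    have [i [nir nia]] := exists_third r a n3.
    apply: (cS' a b i c) => //; rewrite 1?eq_sym //;
      apply: arm_c; by rewrite // -rp -bq xpair_eqE (eq_sym c) (negPf nbc) andbF.
  have [[ap cq]|uac] := eqVneq (a, c) (p, q).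
    have [j [njb njc]] := exists_third b c m3.
    apply: (cS' r j a b) => //; rewrite 1?eq_sym //.
    by apply: arm_r; rewrite // -ap xpair_eqE eq_sym (negPf nar).
    by apply: arm_r.
  apply: (cS' a c r b) => //; first by rewrite eq_sym.
    exact: arm_c.
  exact: arm_r.
Qed.
Lemma mobile_card S : 2 < n -> 2 < m -> mobile rook S -> #|S| <= n + m - 3.
Proof.
move=> n3 m3 [/general_position_corner_free cS [k [C [C0 leg cov]]]].
have := corner_free_card cS.
have [eS _|] := eqVneq #|S| (n + m - 2); last by lia.
have [r [c Sx]] := corner_free_extremal n3 m3 cS eS.
(* Without moves the centre stays unvisited; otherwise the first move contradicts [cross_stuck]. *)
case: k leg cov => [_ /(_ (r, c)) [i]|k /(_ 0 isT)].
  by rewrite leqn0 => /eqP ->; rewrite C0 Sx inE /= !eqxx.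
by rewrite C0 Sx => /cross_stuck [].
Qed.

(** * Configurations given by predicates on coordinates *)

Definition cells (P : nat -> nat -> bool) : {set V} := [set x : V | P x.1 x.2].

(** Coordinates are natural numbers here, so that the conditions on explicit configurations and
    moves become arithmetic for [lia]. *)
Definition corner_free_pred (P : nat -> nat -> bool) := forall a b c d,
  a < n -> b < m -> c < n -> d < m -> P a b -> P a d -> P c d -> a = c \/ b = d.

Lemma general_position_cells P :
  corner_free_pred P -> general_position rook (cells P).
Proof.
move=> cP; apply: corner_free_general_position => a b c d; rewrite !inE /=.
move=> ab ad cd; case: (cP a b c d) => //; [left|right]; exact: val_inj.
Qed.

Lemma legal_move_cells (P Q : nat -> nat -> bool) a b c d : a < n -> b < m -> c < n -> d < m ->
  (a == c) (+) (b == d) -> P a b -> ~~ P c d ->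
  (forall i j, i < n -> j < m ->
     Q i j = (i == c) && (j == d) || ~~ ((i == a) && (j == b)) && P i j) ->
  corner_free_pred Q -> legal_move rook (cells P) (cells Q).
Proof.
move=> an bm cn dm adj Pab Pcd QE cQ.
exists (Ordinal an, Ordinal bm), (Ordinal cn, Ordinal dm); split.
- by rewrite inE.
- rewrite /cart_prod /complete_graph /= -!val_eqE /=; move: adj.
  by case: (a == c); case: (b == d).
- by rewrite inE.
- by apply/setP=> -[i j]; rewrite !inE QE // !xpair_eqE -!val_eqE.
- exact: general_position_cells.
Qed.

Lemma legal_step_cells (P Q : nat -> nat -> bool) a b c d : a < n -> b < m -> c < n -> d < m ->
  (a == c) (+) (b == d) -> P a b -> ~~ P c d ->
  (forall i j, i < n -> j < m ->
     Q i j = (i == c) && (j == d) || ~~ ((i == a) && (j == b)) && P i j) ->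
  corner_free_pred P -> corner_free_pred Q ->
  connect (legal_step rook) (cells P) (cells Q).
Proof.
move=> an bm cn dm adj Pab Pcd QE cP cQ; apply/connect1/asboolP; split.
  exact: general_position_cells.
exact: (@legal_move_cells P Q a b c d).
Qed.

(** * The tour of the short cross for [m >= 3] *)

Definition short_cross_pred j0 i j :=
  (j == 0) && (i != 0) || (j != 0) && (i == 0) && (j != j0).

Lemma corner_free_short_cross j0 : corner_free_pred (short_cross_pred j0).
Proof. by move=> a b c d _ _ _ _; rewrite /short_cross_pred; lia. Qed.

(* In the short cross, the robot [(i0,0)] has moved to [(i0,j0)]. *)
Definition detached_pred i0 j0 i j :=
  (j == 0) && (i != 0) && (i != i0)
  || (j != 0) && ((i == 0) && (j != j0) || (i == i0) && (j == j0)).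

Lemma corner_free_detached i0 j0 : corner_free_pred (detached_pred i0 j0).
Proof. by move=> a b c d _ _ _ _; rewrite /detached_pred; lia. Qed.

(* The robots [(0,j)] with [j <= k] have moved to [(1,j)]. *)
Definition shifted_pred k i j := (j == 0) && (1 < i) || (j != 0) && (i == (j <= k)).

Lemma corner_free_shifted k : corner_free_pred (shifted_pred k).
Proof. by move=> a b c d _ _ _ _; rewrite /shifted_pred; lia. Qed.

(** This is again a short cross, now centred at [(1,0)] and without [(1,m-1)]; it occupies the old
    centre [(0,0)]. *)
Definition centred_pred i j :=
  (j == 0) && (i != 1) || (j != 0) && (i == 1) && (j < m.-1).

Lemma corner_free_centred : corner_free_pred centred_pred.
Proof. by move=> a b c d _ _ _ _; rewrite /centred_pred; lia. Qed.

(** The robot at [(0,j0)] slides into the gap [(0,1)], so the gap can be put anywhere on the arm. *)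
Lemma short_cross_rotate j0 : 2 < n -> 2 < m -> 0 < j0 < m ->
  connect (legal_step rook) (cells (short_cross_pred 1)) (cells (short_cross_pred j0)).
Proof.
move=> n3 m3 /andP [j0p j0m]; have [->|nj] := eqVneq j0 1; first exact: connect0.
apply: (@legal_step_cells _ _ 0 j0 0 1); rewrite /short_cross_pred; try lia.
- exact: corner_free_short_cross.
- exact: corner_free_short_cross.
Qed.

Lemma short_cross_detach i0 j0 : 2 < n -> 2 < m -> 0 < i0 < n -> 0 < j0 < m ->
  connect (legal_step rook) (cells (short_cross_pred j0)) (cells (detached_pred i0 j0)).
Proof.
move=> n3 m3 /andP [i0p i0n] /andP [j0p j0m].
apply: (@legal_step_cells _ _ i0 0 i0 j0);
  rewrite /short_cross_pred /detached_pred; try lia.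
- exact: corner_free_short_cross.
- exact: corner_free_detached.
Qed.

Lemma short_cross_shift k : 2 < n -> 2 < m -> 0 < k < m.-1 ->
  connect (legal_step rook) (cells (short_cross_pred 1)) (cells (shifted_pred k)).
Proof.
move=> n3 m3; elim: k => // k IH ltk.
have [->|nk] := eqVneq k 0.
  (* Since [(0,1)] is the gap, column 1 is filled by the robot from [(1,0)], which also frees row 1
     of column 0. *)
  apply: (@legal_step_cells _ _ 1 0 1 1);
    rewrite /short_cross_pred /shifted_pred; try lia.
  - exact: corner_free_short_cross.
  - exact: corner_free_shifted.
apply: connect_trans (IH _) _; first by lia.
apply: (@legal_step_cells _ _ 0 k.+1 1 k.+1); rewrite /shifted_pred; try lia.
- exact: corner_free_shifted.
- exact: corner_free_shifted.
Qed.

Lemma short_cross_centre : 2 < n -> 2 < m ->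
  connect (legal_step rook) (cells (short_cross_pred 1)) (cells centred_pred).
Proof.
move=> n3 m3; apply: connect_trans (@short_cross_shift m.-2 n3 m3 _) _; first by lia.
(* Only [(0,m-1)] is still occupied in row 0, so its robot can slide to the centre. *)
apply: (@legal_step_cells _ _ 0 m.-1 0 0); rewrite /shifted_pred /centred_pred; try lia.
- exact: corner_free_shifted.
- exact: corner_free_centred.
Qed.

Lemma mobile_short_cross : 2 < n -> 2 < m ->
  mobile rook (cells (short_cross_pred 1)).
Proof.
move=> n3 m3; apply: mobile_connect.
- exact: rook_sym.
- exact/general_position_cells/corner_free_short_cross.
move=> [i j]; have [jm i_n] := (ltn_ord j, ltn_ord i).
have [j0|nj] := eqVneq (j : nat) 0; have [i0|ni] := eqVneq (i : nat) 0.
- exists (cells centred_pred); first exact: short_cross_centre.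
  by rewrite inE /centred_pred /= j0 i0.
- exists (cells (short_cross_pred 1)); first exact: connect0.
  by rewrite inE /short_cross_pred /= j0 /= ni.
(* The gap is put in column 2 if [j] is 1 and in column 1 otherwise, hence never at [j]. *)
- exists (cells (short_cross_pred (j == 1 :> nat).+1)); first by apply: short_cross_rotate; lia.
  by rewrite inE /short_cross_pred /=; lia.
(* For a cell off both arms, the gap is first brought to column [j]; that column is then empty and
   can receive the robot from [(i,0)]. *)
- exists (cells (detached_pred i j)).
    apply: (connect_trans (@short_cross_rotate j n3 m3 _)); first by lia.
    by apply: short_cross_detach; lia.
  by rewrite inE /detached_pred /=; lia.
Qed.

Lemma card_short_cross : 2 < n -> 2 < m -> #|cells (short_cross_pred 1)| = n + m - 3.
Proof.
move=> n3 m3.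
have n0 : 0 < n by lia. have m0 : 0 < m by lia. have m1 : 1 < m by lia.
pose r := Ordinal n0; pose c := Ordinal m0; pose j1 := Ordinal m1.
have -> : cells (short_cross_pred 1) =
    setX [set~ r] [set c] :|: setX [set r] (~: [set c; j1]).
  apply/setP=> -[i j]; rewrite !inE -!val_eqE /= /short_cross_pred; lia.
have /eqP disj : setX [set~ r] [set c] :&: setX [set r] (~: [set c; j1]) == set0.
  by apply/eqP/setP=> -[i j]; rewrite !inE -!val_eqE /=; lia.
rewrite cardsU disj cards0 !cardsX !cards1 cardsC1 cardsCs setCK cards2 !card_ord /=.
lia.
Qed.

(** * Bounds on [mob] and the tour for [m <= 2] *)

Lemma mob_leq k : (forall S, mobile rook S -> #|S| <= k) -> mob rook <= k.
Proof. by move=> leS; apply/bigmax_leqP=> S /asboolP; apply: leS. Qed.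

Lemma leq_mob S : mobile rook S -> #|S| <= mob rook.
Proof.
move=> mS; apply: (@leq_bigmax_cond _ (fun S => `[< mobile rook S >]) (fun S => #|S|)).
exact/asboolP.
Qed.

(* The robots [(i,0)] with [i < k] have moved to [(i,1)]. *)
Definition moved_pred k i (j : nat) := j == (i < k).

Lemma corner_free_moved k : corner_free_pred (moved_pred k).
Proof. by move=> a b c d _ _ _ _; rewrite /moved_pred; lia. Qed.

Lemma mobile_copy : 0 < m <= 2 -> mobile rook (cells (moved_pred 0)).
Proof.
move=> m12; split; first exact/general_position_cells/corner_free_moved.
(* For [m = 1] the initial set is the whole graph and no move is made; for [m = 2] each robot moves
   once. *)
exists (if m == 1 then 0 else n), (fun k => cells (moved_pred k)); split=> //.
- move=> k; case: ifP => // m2 ltk.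
  apply: (@legal_move_cells _ _ k 0 k 1); rewrite /moved_pred; try lia.
  exact: corner_free_moved.
- move=> [i j]; have [jm i_n] := (ltn_ord j, ltn_ord i).
  have [j0|nj] := eqVneq (j : nat) 0.
    by exists 0 => //; rewrite inE /moved_pred /= j0.
  exists i.+1; first by case: ifP; lia.
  by rewrite inE /moved_pred /=; lia.
Qed.

Lemma card_copy : 0 < m -> #|cells (moved_pred 0)| = n.
Proof.
move=> m0; pose c := Ordinal m0.
have -> : cells (moved_pred 0) = setX setT [set c].
  by apply/setP=> -[i j]; rewrite !inE -!val_eqE /= /moved_pred; lia.
by rewrite cardsX cards1 cardsT card_ord muln1.
Qed.

End RookGraph.

Theorem theorem2p4 (n m : nat) (hm : 1 <= m) (hmn : m <= n) :
  mob (cart_prod (@complete_graph n) (@complete_graph m)) =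
    if m \in [:: 1; 2] then n else n + m - 3.
Proof.
apply/eqP; rewrite eqn_leq; rewrite !inE; case: ifP => m12; apply/andP; split.
(* For [m <= 2] the term [n + m - 2] is at most [n], so the general bound is already [n]. *)
- apply: mob_leq => S [/general_position_corner_free /corner_free_card].
  by lia.
- by rewrite -{1}(card_copy n hm); apply/leq_mob/mobile_copy; lia.
- by apply: mob_leq => S; apply: mobile_card; lia.
- by rewrite -card_short_cross; first apply/leq_mob/mobile_short_cross; lia.
Qed.
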